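(* Fix an integer $k\ge 2$ and let $N=\binom{n}{k-1}$. Let $m=m(n)$ be a sequence of positive integers, and consider the Minimum Degree Game with parameter $m$ and bias $b$ on the complete $k$-uniform hypergraph $H_{n,k}$. (i) Suppose $m=o(\log n)$ and write $b=\frac{\beta N}{\log n}$. Then for every fixed $\varepsilon>0$ and all sufficiently large $n$: Maker wins the game if $\beta\le 1-\varepsilon$, and Breaker wins the game if $\beta\ge 1+\varepsilon$. (ii) Suppose $m=\Omega(\log n)$. Then for every fixed $\gamma<1$ and all sufficiently large $n$, Maker wins the game if $b\le \frac{\gamma N}{km+\log n}$.
   Context: $H_{n,k}$ is the complete $k$-uniform hypergraph on $n$ vertices (all $k$-subsets of an $n$-set are edges). In a Maker-Breaker game with bias $b$ (a positive integer) on $H_{n,k}$, two players alternately claim previously unclaimed edges: in each round Maker first claims one edge and then Breaker claims $b$ edges (or all remaining edges, if fewer than $b$ remain). Play continues until all edges are claimed. Maker wins if the hypergraph formed by the edges she has claimed has the desired property; otherwise Breaker wins. ''A player wins'' means that this player has a winning strategy. In the Minimum Degree Game with parameter $m$, the desired property is that every vertex has degree at least $m$ in Maker's hypergraph, where the degree of a vertex $v$ is the number of edges containing $v$. Here $\log$ is the natural logarithm, $k$ is fixed and asymptotic notation is as $n\to\infty$. *)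

(* Defs.v *)
From mathcomp Require Import all_boot.

Set Implicit Arguments.
Unset Strict Implicit.
Unset Printing Implicit Defensive.

Section MakerBreaker.
Variables (T : finType) (X : {set T}) (b : nat).

(* A round consists of Maker's element and the set of elements with which
   Breaker answers; since Breaker's b claims within a round are consecutive,
   their order carries no information. *)
Definition round : Type := T * {set T}.

(* Rounds already played, the most recent one first. *)
Definition history : Type := seq round.

Definition maker_claimed (h : history) : {set T} := [set x in unzip1 h].

Definition breaker_claimed (h : history) : {set T} := \bigcup_(r <- h) r.2.

Definition unclaimed (h : history) : {set T} :=
  X :\: (maker_claimed h :|: breaker_claimed h).

Definition maker_legal (h : history) (x : T) : bool := x \in unclaimed h.

Definition breaker_legal (h : history) (x : T) (S : {set T}) : bool :=
  let rest := unclaimed h :\ x in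
  (S \subset rest) && (#|S| == minn b #|rest|).

Fixpoint legal_history (h : history) : bool :=
  if h is r :: h' then
    [&& legal_history h', maker_legal h' r.1 & breaker_legal h' r.1 r.2]
  else true.

Definition complete (h : history) : bool := unclaimed h == set0.

Definition maker_strategy (sigma : history -> T) : Prop :=
  forall h, legal_history h -> ~~ complete h -> maker_legal h (sigma h).

Definition breaker_strategy (tau : history -> T -> {set T}) : Prop :=
  forall h x, legal_history h -> maker_legal h x -> breaker_legal h x (tau h x).

Fixpoint maker_follows (sigma : history -> T) (h : history) : bool :=
  if h is r :: h' then maker_follows sigma h' && (r.1 == sigma h') else true.

Fixpoint breaker_follows (tau : history -> T -> {set T}) (h : history) : bool :=
  if h is r :: h' then breaker_follows tau h' && (r.2 == tau h' r.1) else true.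

Definition maker_wins (W : pred {set T}) : Prop :=
  exists2 sigma, maker_strategy sigma &
    forall h, legal_history h -> complete h -> maker_follows sigma h ->
      W (maker_claimed h).

Definition breaker_wins (W : pred {set T}) : Prop :=
  exists2 tau, breaker_strategy tau &
    forall h, legal_history h -> complete h -> breaker_follows tau h ->
      ~~ W (maker_claimed h).

End MakerBreaker.

Definition complete_hypergraph (n k : nat) : {set {set 'I_n}} :=
  [set e : {set 'I_n} | #|e| == k].

Definition degree (n : nat) (M : {set {set 'I_n}}) (v : 'I_n) : nat :=
  #|[set e in M | v \in e]|.

Definition min_degree_geq (n m : nat) (M : {set {set 'I_n}}) : bool :=
  [forall v, m <= degree M v].

Definition maker_wins_min_degree (n k m b : nat) : Prop :=
  maker_wins (complete_hypergraph n k) b (@min_degree_geq n m).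

Definition breaker_wins_min_degree (n k m b : nat) : Prop :=
  breaker_wins (complete_hypergraph n k) b (@min_degree_geq n m).

(* Main.v *)
(* Maker, bias at least a large constant. Call a vertex of Maker-degree less
   than m active. Maker claims any edge at an active vertex v of maximal danger
   d_B(v) - k b d_M(v). For every set J of active vertices the mean danger on J
   is at most a level a_|J|: a Breaker round adds at most k b to the total
   danger on J, which is repaid when v lies in J, and otherwise J was part of
   the set v |: J, whose mean was no smaller since v was most dangerous. This
   costs k b / j per step, which is affordable only while j is at least a
   constant fraction of n. Below that, J spans few edges, so counting every
   Breaker edge meeting J once reduces the cost to b / j plus a codegree. Hence
   a_1 = (1 + o(1)) b log n + o(N), while a vertex Maker cannot serve any more
   has danger at least N (1 - o(1)) - (m - 1)(1 + k b).

   Maker, bounded bias. Here m (1 + k b) may exceed N, and Maker plays instead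
   the potential sum_v (1 + mu)^(d_B v) (1 - nu)^(d_M v) with nu close to b mu,
   always claiming the heaviest edge; this yields Maker-degree
   (1 - o(1)) N / (b + 1), and b + 1 <= k b.

   Breaker first claims all edges with two or more vertices in a set U of size
   of order n / log n, which takes too few rounds for Maker to touch more than
   half of U. On the remaining vertices of U the stars are disjoint, and he
   plays the box game, spreading his b edges evenly over the untouched stars. *)
Require Import Defs.
From HB Require Import structures.
From mathcomp Require Import all_boot all_order all_algebra.
From mathcomp Require Import boolp zify ring lra.
Import Order.TTheory GRing.Theory Num.Theory.

Set Implicit Arguments.
Unset Strict Implicit.
Unset Printing Implicit Defensive.

(** The rules fix the exact size of Breaker's answer; this pads a partial answer [P] to a legal
    one. *)
Lemma subset_of_card (T : finType) (P R : {set T}) (c : nat) :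
  P \subset R -> #|P| <= c -> c <= #|R| ->
  exists2 S : {set T}, P \subset S & (S \subset R) && (#|S| == c).
Proof.
move=> sPR; elim: c => [|c IH] Pc cR.
  exists set0; first by move: Pc; rewrite leqn0 cards_eq0 => /eqP ->.
  by rewrite sub0set cards0.
move: Pc; rewrite leq_eqVlt => /orP [/eqP Pc|Pc].
  by exists P; rewrite // sPR Pc eqxx.
have [S sPS /andP [sSR /eqP cS]] := IH Pc (ltnW cR).
have /set0Pn [y] : R :\: S != set0.
  by rewrite -card_gt0 cardsD (setIidPr sSR) subn_gt0 cS.
rewrite inE => /andP [yS yR]; exists (y |: S).
  by apply: subset_trans sPS _; exact: subsetUr.
by rewrite subUset sub1set yR sSR cardsU1 yS cS /=.
Qed.

(** * Winning strategies from invariants of positions *)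

Section Positions.
Variables (T : finType) (X : {set T}) (b : nat).
Implicit Types (M B S : {set T}) (h : history T).

Lemma maker_claimed_nil : maker_claimed [::] = set0 :> {set T}.
Proof. by apply/setP => y; rewrite !inE. Qed.

Lemma breaker_claimed_nil : breaker_claimed [::] = set0 :> {set T}.
Proof. by rewrite /breaker_claimed big_nil. Qed.

Lemma maker_claimed_cons x S h :
  maker_claimed ((x, S) :: h) = x |: maker_claimed h.
Proof. by apply/setP => y; rewrite !inE. Qed.

Lemma breaker_claimed_cons x S h :
  breaker_claimed ((x, S) :: h) = S :|: breaker_claimed h.
Proof. by rewrite /breaker_claimed big_cons. Qed.

Lemma legal_history_sets h : legal_history X b h ->
  [/\ maker_claimed h \subset X, breaker_claimed h \subset X
    & [disjoint maker_claimed h & breaker_claimed h]].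
Proof.
elim: h => [_|[x S] h IH /=].
  rewrite /breaker_claimed big_nil disjoint_sym disjoints_subset !sub0set.
  by split=> //; apply/subsetP => y; rewrite !inE.
case/and3P => /IH [sMX sBX dMB]; rewrite /maker_legal /unclaimed !inE.
rewrite negb_or => /andP [/andP [xM xB] xX] /andP [sS _].
rewrite maker_claimed_cons breaker_claimed_cons.
have SP y : y \in S -> [/\ y != x, y \notin maker_claimed h,
    y \notin breaker_claimed h & y \in X].
  by move/(subsetP sS); rewrite !inE negb_or => /and3P [-> /andP [-> ->] ->].
split; first by rewrite subUset sub1set xX.
  by rewrite subUset sBX andbT; apply/subsetP => y /SP [].
rewrite disjoints_subset; apply/subsetP => y; rewrite !inE negb_or.
case/orP => [/eqP ->|yM].
  by rewrite xB andbT; apply/negP => /SP []; rewrite eqxx.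
have {}yM : y \in maker_claimed h by rewrite inE.
rewrite (disjointFr dMB yM) andbT; apply/negP => /SP [].
by rewrite yM.
Qed.

Lemma complete_breaker_claimed h : legal_history X b h -> complete X h ->
  breaker_claimed h = X :\: maker_claimed h.
Proof.
case/legal_history_sets => sMX sBX dMB; rewrite /complete /unclaimed setD_eq0.
move=> sX; apply/setP => y; rewrite in_setD; apply/idP/andP.
  by move=> yB; rewrite (subsetP sBX) // (disjointFl dMB yB).
by case=> yM /(subsetP sX); rewrite in_setU (negPf yM).
Qed.

(** Histories are forgotten: an invariant of the claimed sets [M] and [B] suffices, and the strategy
    comes from choice. A complete position has [B = X :\: M], so only such pairs are judged.
    [#|S| <= b] covers a short last round; [x0] is the value at illegal or complete histories. *)
Lemma maker_wins_position (x0 : T) (I : {set T} -> {set T} -> Prop)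
    (W : pred {set T}) :
  I set0 set0 ->
  (forall M B, M \subset X -> B \subset X -> [disjoint M & B] -> I M B ->
    X :\: (M :|: B) != set0 ->
    exists2 x, x \in X :\: (M :|: B) & forall S,
      S \subset (X :\: (M :|: B)) :\ x -> #|S| <= b -> I (x |: M) (S :|: B)) ->
  (forall M, M \subset X -> I M (X :\: M) -> W M) ->
  maker_wins X b W.
Proof.
move=> I0 Istep Iend; pose J h := I (maker_claimed h) (breaker_claimed h).
have /choice [sigma sigmaP] : forall h, exists x, legal_history X b h ->
    ~~ complete X h -> maker_legal X h x /\
    (J h -> forall S, breaker_legal X b h x S -> J ((x, S) :: h)).
  move=> h; have [/andP [lh nc]|] :=
    boolP (legal_history X b h && ~~ complete X h); last first.
    by rewrite negb_and => /orP [/negP nl|/negP nc]; exists x0.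
  have [Jh|nJ] := EM (J h); last first.
    by case/set0Pn: (nc) => x xh; exists x.
  have [sMX sBX dMB] := legal_history_sets lh.
  have [x xh xP] := Istep _ _ sMX sBX dMB Jh nc.
  exists x => _ _; split=> // _ S /andP [sS /eqP cS].
  rewrite /J maker_claimed_cons breaker_claimed_cons.
  by apply: xP => //; rewrite cS geq_minl.
exists sigma => [h lh nc|h lh ch fh]; first by case: (sigmaP h lh nc).
suff Jh : J h.
  apply: Iend; first by case: (legal_history_sets lh).
  by rewrite -complete_breaker_claimed.
elim: h lh fh {ch} => [_ _|[x S] h IH /= /and3P [lh xh Sh] /andP [fh /eqP xE]].
  by rewrite /J maker_claimed_nil breaker_claimed_nil.
move: (xh); rewrite /maker_legal => xh'.
have nc : ~~ complete X h by apply/set0Pn; exists x.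
have [_ sP] := sigmaP h lh nc.
by rewrite xE; apply: sP; [exact: IH | rewrite -xE].
Qed.

(** Choice now runs over pairs of a history and Maker's move, and the answer must have the exact
    legal size; where the invariant fails, any legal answer is taken. *)
Lemma breaker_wins_position (I : {set T} -> {set T} -> Prop)
    (W : pred {set T}) :
  I set0 set0 ->
  (forall M B x, M \subset X -> B \subset X -> [disjoint M & B] -> I M B ->
    x \in X :\: (M :|: B) ->
    exists S, [/\ S \subset (X :\: (M :|: B)) :\ x,
      #|S| = minn b #|(X :\: (M :|: B)) :\ x| & I (x |: M) (S :|: B)]) ->
  (forall M, M \subset X -> I M (X :\: M) -> ~~ W M) ->
  breaker_wins X b W.
Proof.
move=> I0 Istep Iend; pose J h := I (maker_claimed h) (breaker_claimed h).
have /choice [tau tauP] : forall hx : history T * T, exists S,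
    legal_history X b hx.1 -> maker_legal X hx.1 hx.2 ->
    breaker_legal X b hx.1 hx.2 S /\ (J hx.1 -> J ((hx.2, S) :: hx.1)).
  move=> [h x] /=; have [/andP [lh xh]|] :=
    boolP (legal_history X b h && maker_legal X h x); last first.
    by rewrite negb_and => /orP [/negP nl|/negP nc]; exists set0.
  have [sMX sBX dMB] := legal_history_sets lh.
  have [Jh|nJ] := EM (J h).
    have [S [sS cS IS]] := Istep _ _ x sMX sBX dMB Jh xh.
    exists S => _ _; rewrite /breaker_legal sS cS eqxx; split=> // _.
    by rewrite /J maker_claimed_cons breaker_claimed_cons.
  have [|S _ /andP [sS /eqP cS]] := subset_of_card
    (sub0set (unclaimed X h :\ x)) _ (geq_minr b _); first by rewrite cards0.
  by exists S => _ _; rewrite /breaker_legal sS cS eqxx.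
exists (fun h x => tau (h, x)) => [h x lh xh|h lh ch fh].
  by case: (tauP (h, x) lh xh).
suff Jh : J h.
  apply: Iend; first by case: (legal_history_sets lh).
  by rewrite -complete_breaker_claimed.
elim: h lh fh {ch} => [_ _|[x S] h IH /= /and3P [lh xh Sh] /andP [fh /eqP SE]].
  by rewrite /J maker_claimed_nil breaker_claimed_nil.
have [_ /= tP] := tauP (h, x) lh xh.
by rewrite /= in SE; rewrite SE; apply: tP; exact: IH.
Qed.

End Positions.

(** * Counting edges, degrees and codegrees *)

Lemma card_bigcup_le (I T : finType) (P : {pred I}) (F : I -> {set T}) :
  #|\bigcup_(i in P) F i| <= \sum_(i in P) #|F i|.
Proof.
elim/big_rec2: _ => [|i c A _ IH]; first by rewrite cards0.
by apply: leq_trans (leq_card_setU _ _) _; rewrite leq_add2l.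
Qed.

(** Adding [A] maps the subsets of [~: A] of size [k - #|A|] bijectively onto these sets. One and
    two points give the size of a star and the codegree. *)
Lemma card_supersets (T : finType) (A : {set T}) (k : nat) : #|A| <= k ->
  #|[set e : {set T} | (A \subset e) && (#|e| == k)]|
    = 'C(#|T| - #|A|, k - #|A|).
Proof.
move=> Ak; have -> : #|T| - #|A| = #|~: A| by rewrite [RHS]cardsCs setCK.
rewrite -(cards_draws (~: A)).
have inj : {in [set B : {set T} | B \subset ~: A & #|B| == k - #|A|] &,
    injective (fun B => A :|: B)}.
  move=> B C; rewrite !inE => /andP [sB _] /andP [sC _] /setP E.
  apply/setP => y; have := E y; rewrite !inE.
  have [yA _|//] := boolP (y \in A).
  have /negPf -> : y \notin B.
    by apply/negP => /(subsetP sB); rewrite inE yA.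
  by apply/esym/negP => /(subsetP sC); rewrite inE yA.
rewrite -(card_in_imset inj); congr #|pred_of_set _|.
apply/setP => e; rewrite inE; apply/andP/imsetP.
  case=> sAe /eqP ce; exists (e :\: A).
    by rewrite inE setDE subsetIr -setDE cardsD (setIidPr sAe) ce eqxx.
  by rewrite setDE setUIr setUCr setIT (setUidPr sAe).
case=> B; rewrite inE => /andP [sB /eqP cB] ->; rewrite subsetUl cardsU.
have -> : A :&: B = set0.
  by apply/eqP; rewrite setI_eq0 disjoint_sym disjoints_subset.
by rewrite cards0 subn0 cB subnKC.
Qed.

Section Degrees.
Variables (n k : nat).
Implicit Types (M B S X : {set {set 'I_n}}) (v w : 'I_n) (J : {set 'I_n}).

Lemma degreeS M B v : M \subset B -> degree M v <= degree B v.
Proof.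
move=> sMB; apply/subset_leq_card/subsetP => e; rewrite !inE => /andP [eM ->].
by rewrite (subsetP sMB).
Qed.

Lemma degreeU M B v : degree (M :|: B) v <= degree M v + degree B v.
Proof.
apply: leq_trans (leq_card_setU _ _); apply/subset_leq_card/subsetP => e.
by rewrite !inE -andb_orl.
Qed.

Lemma degree_disjointU M B v : [disjoint M & B] ->
  degree (M :|: B) v = degree M v + degree B v.
Proof.
move=> dMB; rewrite /degree -cardsUI.
have -> : [set e in M | v \in e] :&: [set e in B | v \in e] = set0.
  apply/setP => e; rewrite !inE; have [eM|//] := boolP (e \in M).
  by rewrite (disjointFr dMB eM) /= andbF.
by rewrite cards0 addn0; congr #|pred_of_set _|; apply/setP => e;
  rewrite !inE -andb_orl.
Qed.

Lemma degree_set1 (e : {set 'I_n}) v : degree [set e] v = (v \in e).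
Proof.
rewrite /degree; have [ve|ve] := boolP (v \in e).
  rewrite (_ : [set _ in _ | _] = [set e]) ?cards1 //.
  by apply/setP => f; rewrite !inE; case: eqP => // ->.
rewrite (_ : [set _ in _ | _] = set0) ?cards0 //.
by apply/setP => f; rewrite !inE; case: eqP => // ->; rewrite (negPf ve).
Qed.

Lemma degree_setU1 (e : {set 'I_n}) M v : e \notin M ->
  degree (e |: M) v = (v \in e) + degree M v.
Proof.
by move=> eM; rewrite degree_disjointU ?degree_set1 // disjoints1.
Qed.

Lemma degree0 v : degree set0 v = 0.
Proof.
by apply/eqP; rewrite cards_eq0; apply/eqP/setP => e; rewrite !inE.
Qed.

Lemma degree_card M v : degree M v <= #|M|.
Proof. by apply/subset_leq_card/subsetP => e; rewrite inE => /andP []. Qed.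

Lemma degree_sum M v : degree M v = \sum_(e in M) (v \in e).
Proof.
rewrite /degree -sum1_card big_mkcond [RHS]big_mkcond; apply: eq_bigr => e _.
by rewrite inE; case: (e \in M) => //=; case: (v \in e).
Qed.

Lemma sum_degree_le M J (c : nat) : (forall e, e \in M -> #|e :&: J| <= c) ->
  \sum_(v in J) degree M v <= #|M| * c.
Proof.
move=> Mc; rewrite (eq_bigr _ (fun v _ => degree_sum M v)) exchange_big /=.
rewrite -sum_nat_const; apply: leq_sum => e /Mc; apply: leq_trans.
rewrite -sum1_card; apply: eq_leq.
rewrite [RHS]big_mkcond [LHS]big_mkcond; apply: eq_bigr => v _.
by rewrite !inE andbC; case: (v \in J).
Qed.

Lemma degree_complete v : 0 < k ->
  degree (complete_hypergraph n k) v = 'C(n.-1, k.-1).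
Proof.
move=> k0; have := @card_supersets _ [set v] k; rewrite cards1 card_ord => /(_ k0).
rewrite !subn1 => <-; congr #|pred_of_set _|; apply/setP => e.
by rewrite !inE sub1set andbC.
Qed.

Lemma codegree_complete v w : 1 < k -> v != w ->
  #|[set e in complete_hypergraph n k | (v \in e) && (w \in e)]|
    = 'C(n - 2, k - 2).
Proof.
move=> k1 vw; have := @card_supersets _ [set v; w] k.
rewrite cards2 vw card_ord => /(_ k1) <-; congr #|pred_of_set _|.
by apply/setP => e; rewrite !inE subUset !sub1set andbC.
Qed.

(** Union bound: each such edge contains [v] together with some [w] of [J]. *)
Lemma card_meet_le v J : 1 < k -> v \notin J ->
  #|[set e in complete_hypergraph n k | (v \in e) && ~~ [disjoint e & J]]|
    <= #|J| * 'C(n - 2, k - 2).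
Proof.
move=> k1 vJ; rewrite -sum_nat_const.
have cE w : w \in J ->
    #|[set e in complete_hypergraph n k | (v \in e) && (w \in e)]|
      = 'C(n - 2, k - 2).
  by move=> wJ; apply: codegree_complete; last apply: contraNneq vJ => ->.
rewrite -(eq_bigr _ cE); apply: leq_trans (card_bigcup_le _ _).
apply/subset_leq_card/subsetP => e; rewrite inE => /and3P [eX ve].
case/pred0Pn => w /andP [/= we wJ]; apply/bigcupP; exists w => //.
by rewrite inE eX ve.
Qed.

End Degrees.

(** * Maker against a large bias: easing the most dangerous vertex *)

Section Easing.
Local Open Scope ring_scope.
Variables (R : realFieldType) (n k b m j0 : nat).
Implicit Types (M B S : {set {set 'I_n}}) (v w : 'I_n) (J : {set 'I_n}).

Definition danger B M v : R :=
  (degree B v)%:R - (k * b)%:R * (degree M v)%:R.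

Definition meeting B J : {set {set 'I_n}} := [set e in B | ~~ [disjoint e & J]].

Definition meeting_danger B M J : R :=
  #|meeting B J|%:R - (k * b)%:R * (\sum_(v in J) (degree M v)%:R).

Definition level_step (i : nat) : R :=
  if (i < j0)%N then 'C(n - 2, k - 2)%:R + b%:R / i%:R else (k * b)%:R / i%:R.

(** The sum is empty at [j = n]: when [J] is the whole vertex set, Maker's vertex always lies in it
    and every round is repaid. *)
Definition level (j : nat) : R := \sum_(j <= i < n) level_step i.

(* At or above the threshold [j0] danger is counted with multiplicity; below it
   each Breaker edge meeting [J] counts once. Both bounds hold at [j0], where
   the former passes on to the latter. *)
Definition danger_bounded M B : Prop :=
  forall J, (forall v, v \in J -> (degree M v < m)%N) ->
    ((j0 <= #|J|)%N ->
       \sum_(v in J) danger B M v <= #|J|%:R * level #|J|) /\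
    ((#|J| <= j0)%N -> meeting_danger B M J <= #|J|%:R * level #|J|).

Lemma level_step_ge0 i : 0 <= level_step i.
Proof. by rewrite /level_step; case: ifP => _; rewrite ?addr_ge0 ?divr_ge0. Qed.

Lemma level_ge0 j : 0 <= level j.
Proof. by apply: sumr_ge0 => i _; exact: level_step_ge0. Qed.

Lemma levelS j : (j < n)%N -> level j = level_step j + level j.+1.
Proof. by move=> jn; rewrite /level big_ltn. Qed.

Lemma meetingE B J :
  meeting B J = \bigcup_(v in J) [set e in B | v \in e].
Proof.
apply/setP => e; rewrite inE; apply/andP/bigcupP.
  case=> eB /pred0Pn [w /andP [/= we wJ]]; exists w => //.
  by rewrite inE eB.
case=> w wJ; rewrite inE => /andP [eB we]; split=> //.
by apply/pred0Pn; exists w; rewrite /= we.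
Qed.

(** An edge with several vertices in [J] counts once on the left and repeatedly on the right. This
    carries the bound with multiplicity over to the other one at [j0]. *)
Lemma meeting_danger_le_sum B M J :
  meeting_danger B M J <= \sum_(v in J) danger B M v.
Proof.
rewrite /meeting_danger /danger sumrB -mulr_sumr lerD2r -natr_sum ler_nat.
by rewrite meetingE; exact: card_bigcup_le.
Qed.

Lemma meeting_setU S B J :
  (#|meeting (S :|: B) J| <= #|S| + #|meeting B J|)%N.
Proof.
apply: leq_trans (_ : #|meeting S J :|: meeting B J| <= _)%N.
  by apply/subset_leq_card/subsetP => e; rewrite !inE -andb_orl.
apply: leq_trans (leq_card_setU _ _) _; rewrite leq_add2r.
by apply/subset_leq_card/subsetP => e; rewrite inE => /andP [].
Qed.

(** Inclusion-exclusion: the edges counted twice contain [v] and meet [J], hence cost one codegree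
    per vertex of [J]. *)
Lemma meeting_setU1 B J v : (1 < k)%N -> B \subset complete_hypergraph n k ->
  v \notin J ->
  (#|meeting B J| + degree B v <=
     #|meeting B (v |: J)| + #|J| * 'C(n - 2, k - 2))%N.
Proof.
move=> k1 sBX vJ; rewrite /degree -cardsUI.
apply: leq_add.
  apply/subset_leq_card/subsetP => e; rewrite meetingE [in X in _ -> X]meetingE.
  rewrite inE => /orP [/bigcupP [w wJ we]|ve]; apply/bigcupP.
    by exists w; rewrite ?in_setU1 ?wJ ?orbT.
  by exists v; rewrite ?setU11.
apply: leq_trans (card_meet_le k1 vJ); apply/subset_leq_card/subsetP => e.
rewrite !inE => /andP [/andP [eB dJ] /andP [_ ve]].
by have := subsetP sBX e eB; rewrite inE ve dJ => ->.
Qed.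

(** Removing an element that is at least the mean of the others does not raise the mean. *)
Lemma mean_le_of_max (j : nat) (s x a : R) : s <= j%:R * x ->
  s + x <= j.+1%:R * a -> s <= j%:R * a.
Proof.
move=> sx sa; have j0' : 0 <= j%:R :> R by [].
rewrite -(@ler_pM2l _ j.+1%:R) ?ltr0Sn //.
have := ler_wpM2l j0' sa; rewrite -natr1 in sa *; lra.
Qed.

(** A round adds at most [k * b] to the danger of [J] counted with multiplicity, and at most [b]
    without. If [v] lies in [J], Maker's edge takes off [k * b], enough in both cases. Otherwise the
    old bound for [v |: J] passes to [J] by maximality of [v], and [level_step] pays for the
    round. *)
Lemma danger_bounded_step M B S v e : (1 < k)%N ->
  M \subset complete_hypergraph n k -> B \subset complete_hypergraph n k ->
  e \in complete_hypergraph n k :\: (M :|: B) ->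
  S \subset complete_hypergraph n k -> (#|S| <= b)%N ->
  v \in e -> (degree M v < m)%N ->
  (forall w, (degree M w < m)%N -> danger B M w <= danger B M v) ->
  danger_bounded M B -> danger_bounded (e |: M) (S :|: B).
Proof.
move=> k1 sMX sBX eF sSX Sb ve dv vmax bnd J actJ.
have eM : e \notin M by move: eF; rewrite !inE negb_or => /andP [/andP []].
have {}actJ w : w \in J -> (degree M w < m)%N.
  move=> /actJ; apply: leq_trans; rewrite ltnS; apply: degreeS.
  exact: subsetUr.
have jx : \sum_(w in J) danger B M w <= #|J|%:R * danger B M v.
  rewrite mulr_natl -sumr_const; apply: ler_sum => w /actJ; exact: vmax.
have degM : \sum_(w in J) (degree M w)%:R + (v \in J)%:R
    <= \sum_(w in J) (degree (e |: M) w)%:R :> R.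
  have [vJ|vJ] := boolP (v \in J); last first.
    rewrite addr0; apply: ler_sum => w _; rewrite ler_nat.
    by apply: degreeS; exact: subsetUr.
  rewrite (bigD1 v) //= [leRHS](bigD1 v) //= degree_setU1 // ve natrD.
  have : \sum_(w in J | w != v) (degree M w)%:R <=
      \sum_(w in J | w != v) (degree (e |: M) w)%:R :> R.
    apply: ler_sum => w _; rewrite ler_nat.
    by apply: degreeS; exact: subsetUr.
  rewrite mulr1n; lra.
have kb0 : 0 <= (k * b)%:R :> R by [].
have bkb : b%:R <= (k * b)%:R :> R by rewrite ler_nat leq_pmull // ltnW.
have sumS : \sum_(w in J) danger (S :|: B) (e |: M) w <=
    \sum_(w in J) danger B M w + (k * b)%:R - (k * b)%:R * (v \in J)%:R.
  rewrite /danger !sumrB -!mulr_sumr.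
  have : \sum_(w in J) (degree (S :|: B) w)%:R <=
      (k * b)%:R + \sum_(w in J) (degree B w)%:R :> R.
    rewrite -!natr_sum -natrD ler_nat.
    apply: leq_trans (_ : \sum_(w in J) (degree S w + degree B w) <= _)%N.
      by apply: leq_sum => w _; exact: degreeU.
    rewrite big_split leq_add2r; apply: leq_trans (sum_degree_le (c := k) _) _.
      move=> f /(subsetP sSX); rewrite inE => /eqP <-.
      by apply: subset_leq_card; exact: subsetIl.
    by rewrite mulnC leq_mul2l Sb orbT.
  have := ler_wpM2l kb0 degM; lra.
have meetS : meeting_danger (S :|: B) (e |: M) J <=
    meeting_danger B M J + b%:R - (k * b)%:R * (v \in J)%:R.
  rewrite /meeting_danger.
  have : #|meeting (S :|: B) J|%:R <= b%:R + #|meeting B J|%:R :> R.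
    rewrite -natrD ler_nat; apply: leq_trans (meeting_setU _ _ _) _.
    by rewrite leq_add2r.
  have := ler_wpM2l kb0 degM; lra.
have actvJ w : w \in v |: J -> (degree M w < m)%N.
  by rewrite in_setU1 => /orP [/eqP ->|/actJ].
have [bndJ1 bndJ2] := bnd _ actJ; have [bndvJ1 bndvJ2] := bnd _ actvJ.
have [->|J0] := eqVneq J finset.set0.
  rewrite !cards0 mul0r /meeting_danger !big_set0 mulr0 subr0; split=> // _.
  rewrite (_ : meeting _ _ = finset.set0) ?cards0 //.
  by rewrite meetingE big_set0.
have jgt0 : 0 < #|J|%:R :> R by rewrite ltr0n card_gt0.
have J1 : (j0 <= #|J|)%N ->
    \sum_(w in J) danger (S :|: B) (e |: M) w <= #|J|%:R * level #|J|.
  move=> jJ; apply: le_trans sumS _; have [vJ|vJ] := boolP (v \in J).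
    by rewrite mulr1 addrK; exact: bndJ1.
  have cvJ : #|v |: J| = #|J|.+1 by rewrite cardsU1 vJ.
  have jn : (#|J| < n)%N by rewrite -cvJ -[leqRHS]card_ord max_card.
  rewrite levelS // /level_step ltnNge jJ /= mulrDr.
  rewrite mulrCA divff ?mulr1 ?gt_eqF // mulr0 subr0 addrC lerD2l.
  apply: mean_le_of_max jx _; rewrite addrC -big_setU1 //= -cvJ.
  by apply: bndvJ1; rewrite cvJ ltnW.
(* The two ranges overlap only at [#|J| = j0], where the bound with multiplicity is the stronger
   one. *)
split=> // jJ; have [jJ'|jJ'] := leqP j0 #|J|.
  exact: le_trans (meeting_danger_le_sum _ _ _) (J1 jJ').
apply: le_trans meetS _; have [vJ|vJ] := boolP (v \in J).
  by have := bndJ2 jJ; rewrite mulr1; lra.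
have cvJ : #|v |: J| = #|J|.+1 by rewrite cardsU1 vJ.
have jn : (#|J| < n)%N by rewrite -cvJ -[leqRHS]card_ord max_card.
rewrite levelS // /level_step jJ' mulr0 subr0.
set C := ('C(_, _)%:R : R).
(* Here [v |: J] still has at most [j0] vertices, so its bound is the one without multiplicity; [C]
   pays for the edges at [v] that also meet [J]. *)
suff : meeting_danger B M J <= #|J|%:R * (level #|J|.+1 + C).
  rewrite 2!mulrDr mulrDr [_ * (_ / _)]mulrCA divff ?gt_eqF // mulr1; lra.
apply: mean_le_of_max (le_trans (meeting_danger_le_sum _ _ _) jx) _.
have := bndvJ2; rewrite cvJ => /(_ jJ').
have : #|meeting B J|%:R + (degree B v)%:R <=
    #|meeting B (v |: J)|%:R + #|J|%:R * C.
  by rewrite -natrM -!natrD ler_nat; exact: meeting_setU1.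
rewrite /meeting_danger /danger big_setU1 //= -!natr1.
have C0 : 0 <= C by rewrite /C.
move: #|J|%:R (level _) (k * b)%:R => j l c; lra.
Qed.

(** For [J = [set v]] the invariant bounds the Breaker-degree of an active [v] by [level 1] plus
    [k * b] times its Maker-degree. By the numerical hypothesis its star is then not exhausted, so
    Maker can always serve it and no vertex is active at the end. *)
Lemma maker_wins_easing : (1 < k)%N -> (0 < n)%N -> (0 < j0)%N ->
  m%:R * (1 + (k * b)%:R) + level 1 < 'C(n.-1, k.-1)%:R ->
  maker_wins_min_degree n k m b.
Proof.
move=> k1 n0 j0_gt0 win.
have full M B v : danger_bounded M B -> (degree M v < m)%N ->
    (degree M v + degree B v < 'C(n.-1, k.-1))%N.
  move=> bnd dv; have [] := bnd [set v] _.
    by move=> w; rewrite inE => /eqP ->.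
  move=> _; rewrite cards1 => /(_ j0_gt0); rewrite mul1r /meeting_danger.
  rewrite big_set1 meetingE big_set1 => dB; rewrite -(ltr_nat R) natrD.
  apply: le_lt_trans win; have : (degree M v)%:R <= m%:R :> R.
    by rewrite ler_nat ltnW.
  have kb0 : 0 <= 1 + (k * b)%:R :> R by rewrite addr_ge0.
  move=> /(ler_wpM2l kb0); rewrite /degree in dB *; lra.
apply: (maker_wins_position finset.set0 (I := danger_bounded)).
- move=> J _; rewrite /meeting_danger; split=> _; last first.
    rewrite (_ : meeting _ _ = finset.set0); last first.
      by apply/setP => e; rewrite !inE.
    rewrite cards0 big1 ?mulr0 ?subr0 ?mulr_ge0 ?level_ge0 // => v _.
    by rewrite degree0.
  rewrite big1 ?mulr_ge0 ?level_ge0 // => v _.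
  by rewrite /danger degree0 mulr0 subr0.
- move=> M B sMX sBX dMB bnd nc.
  have [v0 dv0|noact] := pickP (fun v => degree M v < m)%N; last first.
    (* With no active vertex left, the invariant concerns only the empty [J], and any edge will
       do. *)
    have /set0Pn [e eF] := nc; exists e => // S _ _ J actJ.
    have -> : J = finset.set0.
      apply/setP => w; rewrite inE; apply/negP => /actJ; rewrite ltnNge.
      rewrite (leq_trans _ (degreeS _ (subsetUr _ _))) //.
      by rewrite leqNgt noact.
    rewrite !cards0 mul0r /meeting_danger !big_set0 mulr0 subr0; split=> // _.
    by rewrite meetingE big_set0 cards0.
  pose v := [arg max_(w > v0 | (degree M w < m)%N) danger B M w]%O.
  have [dv vmax] : (degree M v < m)%N /\
      forall w, (degree M w < m)%N -> danger B M w <= danger B M v.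
    by rewrite /v; case: arg_maxP.
  have [e eF ve] : exists2 e, e \in complete_hypergraph n k :\: (M :|: B)
      & v \in e.
    have := full M B v bnd dv; rewrite -degree_disjointU //.
    rewrite -(degree_complete v (ltnW k1)) => lt.
    have [/pred0P p0|/pred0Pn [e]] := boolP
        (pred0b [pred e in complete_hypergraph n k :\: (M :|: B) | v \in e]).
      move: lt; rewrite ltnNge => /negP []; apply/subset_leq_card/subsetP => e.
      rewrite !inE => /andP [eX ve]; move: (p0 e); rewrite !inE eX ve !andbT.
      by move=> /negbFE.
    by rewrite /= => /andP [eF ve]; exists e.
  exists e => // S sS cS.
  apply: (danger_bounded_step k1 sMX sBX eF _ cS ve dv vmax bnd).
  by apply: subset_trans sS _; rewrite setDDl; exact: subsetDl.
- move=> M sMX bnd; apply/forallP => v; rewrite leqNgt; apply/negP => dv.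
  have := full _ _ v bnd dv; rewrite -degree_disjointU; last first.
    by rewrite disjoint_sym disjoints_subset setDE subsetIr.
  rewrite setDE setUIr setUCr setIT (setUidPr sMX).
  by rewrite degree_complete ?ltnn // ltnW.
Qed.

End Easing.

(** * Maker against a bounded bias: an exponential potential *)

Section Potential.
Local Open Scope ring_scope.
Variables (R : realFieldType) (n k b m : nat) (mu : R).
Hypothesis mu_gt0 : 0 < mu.
Implicit Types (M B S : {set {set 'I_n}}) (v w : 'I_n) (e f : {set 'I_n}).

(* Chosen so that [b] further Breaker edges, each no heavier than Maker's, cannot
   restore what Maker's edge took off the potential. *)
Definition discount : R := b%:R * mu * (1 + mu) ^+ b.

Hypothesis discount_le1 : discount <= 1.

Definition weight B M v : R :=
  (1 + mu) ^+ degree B v * (1 - discount) ^+ degree M v.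

Lemma addr1_mu_ge0 : 0 <= 1 + mu.
Proof. by rewrite addr_ge0 // ltW. Qed.

Hint Resolve addr1_mu_ge0 : core.

Lemma weight_ge0 B M v : 0 <= weight B M v.
Proof. by rewrite mulr_ge0 // exprn_ge0 // subr_ge0. Qed.

(** Linearised with one slope for all [s <= b], so that the effect of Breaker's edges at a vertex is
    additive over the edges. *)
Lemma exp_le_linear (s : nat) : (s <= b)%N ->
  (1 + mu) ^+ s <= 1 + s%:R * (mu * (1 + mu) ^+ b).
Proof.
have mu1 : 1 <= 1 + mu by rewrite lerDl ltW.
elim: s => [_|s IH sb]; first by rewrite expr0 mul0r addr0.
have := IH (ltnW sb); rewrite exprS -natr1 => le.
have : mu * (1 + mu) ^+ s <= mu * (1 + mu) ^+ b.
  by rewrite ler_pM2l // ler_weXn2l // ltnW.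
lra.
Qed.

(** Maker's edge, of weight [W], takes off [discount * W]. Each of Breaker's at most [b] edges
    weighs at most [W] and adds at most [mu * (1 + mu) ^+ b] times its weight, together no more than
    was taken off. *)
Lemma potential_step M B S e : e \notin M -> (#|S| <= b)%N ->
  (forall f, f \in S ->
     \sum_(v in f) weight B M v <= \sum_(v in e) weight B M v) ->
  \sum_v weight (S :|: B) (e |: M) v <= \sum_v weight B M v.
Proof.
move=> eM Sb emax; set W := \sum_(v in e) _ in emax *.
have W0 : 0 <= W by apply: sumr_ge0 => v _; exact: weight_ge0.
have nu0 : 0 <= discount.
  by rewrite !mulr_ge0 // ?exprn_ge0 // ltW.
have c0 : 0 <= mu * (1 + mu) ^+ b.
  by rewrite mulr_ge0 // ?exprn_ge0 // ltW.
have eased : \sum_v weight B (e |: M) v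
    = \sum_v weight B M v - discount * W.
  rewrite /W mulr_sumr [X in _ - X]big_mkcond -sumrB; apply: eq_bigr => v _.
  rewrite /weight degree_setU1 //; case: (v \in e); last by rewrite subr0.
  rewrite add1n exprS.
  move: discount (_ ^+ degree B v) (_ ^+ degree M v) => d p q; ring.
have eased_le v : weight B (e |: M) v <= weight B M v.
  rewrite /weight ler_wpM2l ?exprn_ge0 //.
  by rewrite ler_wiXn2l ?subr_ge0 ?lerBlDr ?lerDl ?degreeS ?subsetUr.
have claimed v : weight (S :|: B) (e |: M) v <= weight B (e |: M) v +
    mu * (1 + mu) ^+ b * ((degree S v)%:R * weight B (e |: M) v).
  have : (1 + mu) ^+ degree (S :|: B) v <=
      (1 + (degree S v)%:R * (mu * (1 + mu) ^+ b)) * (1 + mu) ^+ degree B v.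
    apply: le_trans (_ : (1 + mu) ^+ (degree S v + degree B v) <= _).
      by rewrite ler_weXn2l ?degreeU // lerDl ltW.
    rewrite exprD ler_wpM2r ?exprn_ge0 //.
    by apply: exp_le_linear; exact: leq_trans (degree_card _ _) Sb.
  have M0 : 0 <= (1 - discount) ^+ degree (e |: M) v.
    by rewrite exprn_ge0 // subr_ge0.
  move=> /(ler_wpM2r M0); rewrite /weight => /le_trans; apply.
  rewrite le_eqVlt; apply/orP; left; apply/eqP.
  move: (_ ^+ degree B v) ((1 - _) ^+ _) (mu * _) => p q c; ring.
apply: le_trans (ler_sum _ (fun v _ => claimed v)) _.
rewrite big_split /= eased -mulr_sumr.
suff : \sum_v (degree S v)%:R * weight B (e |: M) v <= b%:R * W.
  by move=> /(ler_wpM2l c0); rewrite /discount; lra.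
have -> : \sum_v (degree S v)%:R * weight B (e |: M) v =
    \sum_(f in S) \sum_(v in f) weight B (e |: M) v.
  under [RHS]eq_bigr do rewrite big_mkcond.
  rewrite exchange_big; apply: eq_bigr => v _.
  rewrite degree_sum natr_sum mulr_suml; apply: eq_bigr => f _.
  by case: (v \in f); rewrite ?mul1r ?mul0r.
apply: le_trans (_ : \sum_(f in S) W <= _).
  by apply: ler_sum => f /emax; apply: le_trans; apply: ler_sum => v _.
by rewrite sumr_const -[leLHS]mulr_natl ler_wpM2r // ler_nat.
Qed.

(** The potential starts at [n] and never grows. A vertex ending with Maker-degree below [m] would
    alone weigh at least the right-hand side of the hypothesis. *)
Lemma maker_wins_potential : (0 < k)%N -> (m <= 'C(n.-1, k.-1))%N ->
  n%:R < (1 + mu) ^+ ('C(n.-1, k.-1) - m) * (1 - discount) ^+ m ->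
  maker_wins_min_degree n k m b.
Proof.
move=> k0 mD win.
apply: (maker_wins_position finset.set0
  (I := fun M B => \sum_v weight B M v <= n%:R)).
- rewrite (eq_bigr (fun=> 1)) ?sumr_const ?card_ord // => v _.
  by rewrite /weight !degree0 !expr0 mulr1.
- move=> M B sMX sBX dMB bnd /set0Pn [e0 e0F].
  pose e := [arg max_(f > e0 in complete_hypergraph n k :\: (M :|: B))
    \sum_(v in f) weight B M v]%O.
  have [eF emax] : e \in complete_hypergraph n k :\: (M :|: B) /\
      forall f, f \in complete_hypergraph n k :\: (M :|: B) ->
        \sum_(v in f) weight B M v <= \sum_(v in e) weight B M v.
    by rewrite /e; case: arg_maxP.
  exists e => // S sS Sb; apply: le_trans (potential_step _ Sb _) bnd.
    by move: eF; rewrite !inE negb_or => /andP [/andP []].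
  by move=> f /(subsetP sS); rewrite in_setD1 => /andP [_ /emax].
- move=> M sMX bnd; apply/forallP => v; rewrite leqNgt; apply/negP => dv.
  have : weight (complete_hypergraph n k :\: M) M v <= n%:R.
    apply: le_trans bnd; rewrite (bigD1 v) //= lerDl.
    by apply: sumr_ge0 => w _; exact: weight_ge0.
  apply/negP; rewrite -ltNge; apply: lt_le_trans win _; rewrite /weight.
  have := degree_disjointU v
    (_ : [disjoint M & complete_hypergraph n k :\: M]).
  rewrite disjoint_sym disjoints_subset setDE subsetIr => /(_ isT).
  rewrite -setDE [M :|: _](_ : _ = complete_hypergraph n k); last first.
    by rewrite setDE setUIr setUCr setIT (setUidPr sMX).
  rewrite degree_complete // => DE.
  apply: ler_pM; rewrite ?exprn_ge0 ?subr_ge0 //.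
    by rewrite ler_weXn2l ?lerDl 1?ltW // DE; lia.
  rewrite ler_wiXn2l ?subr_ge0 // 1?ltnW // lerBlDr lerDl.
  by rewrite !mulr_ge0 // ?exprn_ge0 // ltW.
Qed.

End Potential.

(** * Breaker: making stars disjoint, then the box game *)

Lemma setD_round (T : finType) (Y M B S : {set T}) (x : T) :
  Y :\: (x |: M :|: (S :|: B)) = ((Y :\: (M :|: B)) :\ x) :\: S.
Proof. by rewrite !setDDl setUACA setUC setUA. Qed.

Section Isolating.
Variables (n k b m u : nat) (U : {set 'I_n}).
Implicit Types (M B S : {set {set 'I_n}}) (v w : 'I_n) (A : {set 'I_n}).

Local Notation X := (complete_hypergraph n k).

Definition overlapping : {set {set 'I_n}} := [set e in X | 1 < #|e :&: U|].

(** Ordered pairs in [U], diagonal included, times the codegree: a crude bound on the overlapping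
    edges. *)
Definition pairs_bound : nat := #|U| * (#|U| * 'C(n - 2, k - 2)).

(* The vertices of [A] are untouched by Maker and the unclaimed edges at them form
   disjoint boxes, whose common size bound shrinks by [b %/ #|A|] whenever
   Maker destroys one box. *)
Definition box_phase M B : Prop :=
  overlapping \subset M :|: B /\
  exists A, [/\ A \subset U, 0 < #|A|, (forall v, v \in A -> degree M v = 0)
    & forall v, v \in A -> degree (X :\: (M :|: B)) v
        <= 'C(n.-1, k.-1) - \sum_(#|A| <= j < u) b %/ j].

(* The left disjunct is the phase in which Breaker still has overlapping edges
   left to claim. *)
Definition breaker_invariant M B : Prop :=
  b * #|M| + #|overlapping :\: (M :|: B)| <= pairs_bound \/ box_phase M B.

Lemma card_overlapping : 1 < k -> #|overlapping| <= pairs_bound.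
Proof.
move=> k1; rewrite /pairs_bound -sum_nat_const.
apply: leq_trans (_ : \sum_(v in U)
  #|[set e in X | (v \in e) && ~~ [disjoint e & U :\ v]]| <= _); last first.
  apply: leq_sum => v vU; apply: leq_trans (card_meet_le k1 _) _.
    by rewrite setD11.
  by rewrite leq_mul2r subset_leq_card ?orbT // subD1set.
apply: leq_trans (card_bigcup_le _ _); apply/subset_leq_card/subsetP => e.
rewrite inE => /andP [eX /card_gt1P [v [w [ve we vw]]]].
move: ve we; rewrite !in_setI => /andP [ve vU] /andP [we wU].
apply/bigcupP; exists v => //; rewrite inE eX ve /=.
by apply/pred0Pn; exists w; rewrite /= we !inE eq_sym vw.
Qed.

(** Maker's edges cover at most [k] vertices each, so at least [u] vertices of [U] are untouched. At
    [#|A| >= u] the sum in [box_phase] is empty and only the trivial degree bound is claimed. *)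
Lemma box_phase_start M B : 0 < k -> M \subset X ->
  0 < u -> u + k * (pairs_bound %/ b).+1 <= #|U| ->
  #|M| <= (pairs_bound %/ b).+1 -> overlapping \subset M :|: B ->
  box_phase M B.
Proof.
move=> k0 sMX u0 Ubig Ms ov; split=> //.
pose A := U :\: \bigcup_(e in M) e.
have uA : u <= #|A|.
  rewrite cardsD leq_subRL; last by apply: subset_leq_card; exact: subsetIl.
  apply: leq_trans Ubig; rewrite addnC leq_add2l.
  apply: leq_trans (subset_leq_card (subsetIr _ _)) _.
  apply: leq_trans (card_bigcup_le _ _) _.
  apply: leq_trans (_ : \sum_(e in M) k <= _).
    by apply: leq_sum => e /(subsetP sMX); rewrite inE => /eqP ->.
  by rewrite sum_nat_const mulnC leq_mul2l Ms orbT.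
exists A; split; first exact: subsetDl.
- exact: leq_trans uA.
- move=> v; rewrite inE => /andP [/bigcupP nv _]; apply/eqP.
  rewrite cards_eq0; apply/eqP/setP => e; rewrite !inE.
  by apply/negP => /andP [eM ve]; apply: nv; exists e.
- move=> v _; rewrite big_geq // subn0 -(degree_complete v k0).
  by apply: degreeS; exact: subsetDl.
Qed.

(** Every overlapping edge is claimed, so a free edge meets at most one box. If Maker hits the box
    of [w], Breaker takes [b %/ #|A :\ w|] edges, or all that remain, from each other box; if she
    hits none, any legal answer works. *)
Lemma box_phase_step M B e : 0 < k ->
  'C(n.-1, k.-1) <= \sum_(1 <= j < u) b %/ j ->
  box_phase M B -> e \in X :\: (M :|: B) ->
  exists S, [/\ S \subset (X :\: (M :|: B)) :\ e,
    #|S| = minn b #|(X :\: (M :|: B)) :\ e| & box_phase (e |: M) (S :|: B)].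
Proof.
move=> k0 win.
have subn_minn q c : c - minn q c <= c - q by lia.
have subn_step d D s q : d <= D - s -> d <= q + (D - (q + s)) by lia.
case=> [ov [A [sAU A0 untouched small]]] eF.
set F := (X :\: (M :|: B)) :\ e.
have eM : e \notin M by move: eF; rewrite !inE negb_or => /andP [/andP []].
have ovS S : overlapping \subset (e |: M) :|: (S :|: B).
  apply: subset_trans ov _; apply/subsetP => f; rewrite !inE.
  by case/orP => ->; rewrite !orbT.
have freeS S : X :\: (e |: M :|: (S :|: B)) = F :\: S.
  exact: setD_round.
have [eA|] := boolP [disjoint e & A].
  have [|S _ /andP [sS /eqP cS]] := subset_of_card
    (sub0set F) _ (geq_minr b _); first by rewrite cards0.
  exists S; split=> //; split=> //; exists A; split=> // v vA.
    by rewrite degree_setU1 // untouched // (disjointFl eA vA).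
  apply: leq_trans (small v vA); rewrite freeS; apply: degreeS.
  by apply: subset_trans (subsetDl _ _) _; rewrite subD1set.
case/pred0Pn => w /andP [/= we wA].
have eX : e \in X by move: eF; rewrite inE => /andP [].
have e1 : #|e :&: U| <= 1.
  rewrite leqNgt; apply/negP => eU.
  have /(subsetP ov) : e \in overlapping by rewrite inE eX.
  by move: eF; rewrite !in_setD => /andP [/negPf ->].
have eAw v : v \in A -> v \in e -> v = w.
  by move=> vA ve; apply: (card_le1_eqP e1);
    rewrite inE ?ve ?we /= (subsetP sAU).
have cA : #|A| = #|A :\ w|.+1 by rewrite (cardsD1 w A) wA.
(* If [w] were the last vertex, [win] would make the bound on its box zero, although [e] is still
   free there. *)
have A1 : 0 < #|A :\ w|.
  rewrite lt0n; apply/negP => /eqP A'0; have := small w wA.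
  rewrite cA A'0 (eqnP win) leqn0 cards_eq0 => /eqP/setP/(_ e).
  by rewrite !inE we andbT; move: eF; rewrite !inE => ->.
set q := b %/ #|A :\ w|.
pose at_vertex v := [set f in F | v \in f].
have /choice [g gP] : forall v, exists G : {set {set 'I_n}},
    G \subset at_vertex v /\ #|G| = minn q (degree F v).
  move=> v; have [|G _ /andP [sG /eqP cG]] := subset_of_card
    (sub0set (at_vertex v)) _ (geq_minr q _); first by rewrite cards0.
  by exists G.
pose P := \bigcup_(v in A :\ w) g v.
have sPF : P \subset F.
  apply/bigcupsP => v _; apply: subset_trans (gP v).1 _.
  by apply/subsetP => f; rewrite inE => /andP [].
have Pb : #|P| <= b.
  apply: leq_trans (card_bigcup_le _ _) _.
  apply: leq_trans (_ : \sum_(v in A :\ w) q <= _).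
    by apply: leq_sum => v _; rewrite (gP v).2 geq_minl.
  by rewrite sum_nat_const mulnC leq_trunc_div.
have [|S sPS /andP [sS /eqP cS]] := subset_of_card sPF _ (geq_minr b _).
  by rewrite leq_min Pb subset_leq_card.
exists S; split=> //; split=> //; exists (A :\ w); split=> //.
- exact: subset_trans (subD1set _ _) sAU.
- move=> v; rewrite !inE => /andP [vw vA]; rewrite degree_setU1 // untouched //.
  by apply/eqP; rewrite addn0 eqb0; apply: contraNN vw => /(eAw v vA) ->.
move=> v; rewrite in_setD1 => /andP [vw vA]; rewrite freeS.
have : degree (F :\: S) v <= degree F v - q.
  apply: leq_trans (_ : #|at_vertex v :\: g v| <= _).
    apply/subset_leq_card/subsetP => f; rewrite !inE => /andP [/andP [fS ->] ->].
    rewrite !andbT; apply: contraNN fS => fg; apply: (subsetP sPS).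
    by apply/bigcupP; exists v => //; rewrite !inE vw.
  rewrite cardsD (setIidPr (gP v).1) (gP v).2; exact: subn_minn.
move=> /leq_trans; apply; rewrite leq_subLR.
have : degree F v <= 'C(n.-1, k.-1) - \sum_(#|A| <= j < u) b %/ j.
  by apply: leq_trans (small v vA); apply: degreeS; rewrite subD1set.
have [uA|uA] := leqP u #|A :\ w|.
  rewrite !big_geq ?cA ?leqW // !subn0 => /leq_trans; apply; exact: leq_addl.
by rewrite (big_ltn uA) -cA -/q; exact: subn_step.
Qed.

(** While at least [b] overlapping edges remain, a round trades [b] of them for one Maker edge and
    preserves the first disjunct. In the round that exhausts them the box phase begins; its nonempty
    [A] leaves a vertex of Maker-degree zero. *)
Lemma breaker_wins_isolating : 1 < k -> 0 < m -> 0 < b -> 0 < u ->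
  u + k * (pairs_bound %/ b).+1 <= #|U| ->
  'C(n.-1, k.-1) <= \sum_(1 <= j < u) b %/ j ->
  breaker_wins_min_degree n k m b.
Proof.
move=> k1 m0 b0 u0 Ubig win.
have start M B : M \subset X ->
    #|M| <= (pairs_bound %/ b).+1 -> overlapping \subset M :|: B ->
    box_phase M B.
  by move=> sMX; apply: box_phase_start; rewrite // ltnW.
apply: (breaker_wins_position (I := breaker_invariant)).
- left; rewrite cards0 muln0 add0n.
  apply: leq_trans (card_overlapping k1); apply: subset_leq_card.
  exact: subsetDl.
- move=> M B e sMX sBX dMB [early|box] eF; last first.
    have [S [sS cS box']] := box_phase_step (ltnW k1) win box eF.
    by exists S; split=> //; right.
  set F := (X :\: (M :|: B)) :\ e.
  have eM : e \notin M by move: eF; rewrite !inE negb_or => /andP [/andP []].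
  set O := (overlapping :\: (M :|: B)) :\ e.
  have sOF : O \subset F.
    apply/setSD/setSD/subsetP => f; rewrite inE => /andP [].
    by [].
  have OE S : overlapping :\: (e |: M :|: (S :|: B)) = O :\: S.
    exact: setD_round.
  have Oc : #|O| <= #|overlapping :\: (M :|: B)|.
    exact/subset_leq_card/subD1set.
  have [Ob|Ob] := leqP b #|O|.
    have [|S _ /andP [sS /eqP cS]] := subset_of_card (sub0set O) _ Ob.
      by rewrite cards0.
    exists S; split; first exact: subset_trans sOF.
      rewrite cS; apply/esym/minn_idPl; apply: leq_trans Ob _.
      exact: subset_leq_card.
    left; rewrite OE cardsU1 eM cardsD (setIidPr sS) cS; lia.
  have [|S sOS /andP [sS /eqP cS]] := subset_of_card sOF _ (geq_minr b _).
    by rewrite leq_min ltnW // subset_leq_card.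
  exists S; split=> //; right; apply: start.
  + rewrite subUset sub1set sMX andbT.
    by move: eF; rewrite inE => /andP [].
  (* The successor in the bound on Maker's edges is her edge of the current round. *)
  + rewrite cardsU1 eM ltnS leq_divRL // mulnC; lia.
  + by rewrite -setD_eq0 OE setD_eq0.
- move=> M sMX inv.
  have XE : M :|: (X :\: M) = X.
    by rewrite setDE setUIr setUCr setIT (setUidPr sMX).
  have sOX : overlapping \subset X.
    by apply/subsetP => f; rewrite inE => /andP [].
  have [_ [A [_ A0 untouched _]]] : box_phase M (X :\: M).
    (* Even if the first disjunct holds at the end, all overlapping edges are then claimed, so a box
       phase can be read off the final position. *)
    case: inv => // early; apply: start => //; last by rewrite XE.
    rewrite ltnW // ltnS leq_divRL // mulnC.
    by apply: leq_trans early; exact: leq_addr.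
  have /card_gt0P [v vA] := A0; rewrite /min_degree_geq negb_forall.
  by apply/existsP; exists v; rewrite -ltnNge untouched.
Qed.

End Isolating.

From mathcomp Require Import all_classical all_reals all_analysis.
Import numFieldNormedType.Exports.
Local Open Scope ring_scope.

(** * Logarithms and harmonic sums *)

Section Logarithm.
Variable R : realType.
Implicit Types x eta : R.

Lemma ln_ge_1subV x : 0 < x -> 1 - x^-1 <= ln x.
Proof.
move=> x0; have := @le_ln1Dx R (x^-1 - 1).
rewrite [1 + _]addrC subrK lnV ?posrE // ltrBrDr addNr invr_gt0 x0 => /(_ isT).
lra.
Qed.

Lemma ln_le_small eta : 0 < eta -> exists c : R, forall x, c <= x -> ln x <= eta * x.
Proof.
move=> eta0; have e2 : 0 < eta / 2 by rewrite divr_gt0.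
(* Sublinearity at [eta / 2 * x] uses half of [eta * x]; beyond this bound the other half absorbs
   [- ln (eta / 2)]. *)
exists (Num.max 1 (- ln (eta / 2) / (eta / 2))) => x.
rewrite ge_max => /andP [x1]; rewrite ler_pdivrMr // => xc.
have x0 : 0 < x by apply: lt_le_trans x1.
have := @ln_sublinear R (eta / 2 * x); rewrite mulr_gt0 // lnM ?posrE // => /(_ isT).
lra.
Qed.

Lemma near_ln_ge (c : R) : \forall n \near \oo%classic, c <= ln (n%:R : R).
Proof.
near=> n; rewrite -ler_expR lnK; last first.
  by rewrite posrE ltr0n; near: n; exact: nbhs_infty_gt.
by apply: ltW; near: n; exact: nbhs_infty_gtr.
Unshelve. all: by end_near. Qed.

Lemma near_ln_le eta : 0 < eta ->
  \forall n \near \oo%classic, ln (n%:R : R) <= eta * n%:R.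
Proof.
move=> /ln_le_small [c cP]; near=> n; apply: cP.
by apply: ltW; near: n; exact: nbhs_infty_gtr.
Unshelve. all: by end_near. Qed.

Lemma near_lnln_le eta : 0 < eta ->
  \forall n \near \oo%classic, ln (ln (n%:R : R)) <= eta * ln n%:R.
Proof.
move=> /ln_le_small [c cP]; near=> n; apply: cP.
by near: n; exact: near_ln_ge.
Unshelve. all: by end_near. Qed.

Lemma lnS_ge (i : nat) : (0 < i)%N ->
  i.+1%:R^-1 <= ln (i.+1%:R : R) - ln i%:R.
Proof.
move=> i0; have i0' : 0 < i%:R :> R by rewrite ltr0n.
have i1 : 0 < i.+1%:R :> R by rewrite ltr0n.
have := @ln_ge_1subV (i.+1%:R / i%:R); rewrite divr_gt0 // => /(_ isT).
rewrite ln_div ?posrE // invf_div => le; apply: le_trans le.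
rewrite -[X in X - _](divff (lt0r_neq0 i1)) -mulrBl -natr1.
by rewrite [i%:R + 1]addrC addrK mul1r.
Qed.

Lemma lnS_le (i : nat) : (0 < i)%N -> ln (i.+1%:R : R) - ln i%:R <= i%:R^-1.
Proof.
move=> i0; have i0' : 0 < i%:R :> R by rewrite ltr0n.
have i1 : 0 < i.+1%:R :> R by rewrite ltr0n.
have := @ln_ge_1subV (i%:R / i.+1%:R); rewrite divr_gt0 // => /(_ isT).
rewrite ln_div ?posrE // invf_div -natr1 mulrDl divff ?gt_eqF // mul1r.
lra.
Qed.

Lemma harmonic_le (p q : nat) : (0 < p)%N -> (p <= q)%N ->
  \sum_(p <= i < q) i%:R^-1 <= 1 + ln (q%:R : R) - ln p%:R.
Proof.
(* Including the term at [q] makes the induction step exactly [lnS_ge]. *)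
move=> p0 pq; suff : \sum_(p <= i < q.+1) i%:R^-1 <= 1 + ln (q%:R : R) - ln p%:R.
  apply: le_trans; rewrite [leRHS]big_nat_recr //= lerDl invr_ge0.
  by [].
elim: q pq => [|q IH]; first by rewrite leqNgt p0.
rewrite leq_eqVlt => /orP [/eqP <-|pq].
  rewrite big_nat1 addrK invf_le1 ?ltr0n // ler1n.
  by [].
rewrite big_nat_recr /=; last by rewrite ltnW.
by apply: le_trans (lerD (IH pq) (lnS_ge (leq_trans p0 pq))) _; lra.
Qed.

Lemma harmonic_ge (u : nat) : (0 < u)%N ->
  ln (u%:R : R) <= \sum_(1 <= j < u) j%:R^-1.
Proof.
elim: u => // -[_ _|u IH _]; first by rewrite big_geq // ln1.
rewrite big_nat_recr //=.
by apply: le_trans (lerD (IH isT) (@lnS_le u.+1 isT)); lra.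
Qed.

End Logarithm.

(** * Star size and codegree compared with [N] *)

Section Binomials.
Variables (R : realType) (n k : nat).
Local Notation D := ('C(n.-1, k.-1)%:R : R).
Local Notation N := ('C(n, k.-1)%:R : R).

Lemma bin_ge (p j : nat) : (0 < j < p)%N -> (p <= 'C(p, j))%N.
Proof.
elim: p j => [|p IH] [|j] // /andP [_]; rewrite ltnS binS => jp.
have [->|j0] := eqVneq j 0%N; first by rewrite bin1 bin0 addn1.
have := IH j; rewrite lt0n j0 jp => /(_ isT).
move: jp; rewrite leq_eqVlt => /orP [/eqP <-|jp].
  by rewrite binn binSn.
have := IH j.+1; rewrite jp => /(_ isT); lia.
Qed.

Lemma star_le : D <= N.
Proof. by rewrite ler_nat leq_bin2l // leq_pred. Qed.

(** By [mul_bin_down] the star is exactly [(n - k.-1) / n] of [N]. *)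
Lemma star_ge (theta : R) : (0 < k)%N -> (0 < n)%N -> k%:R <= theta * n%:R ->
  (1 - theta) * N <= D.
Proof.
move=> k0 n0 kn; have n0' : 0 < n%:R :> R by rewrite ltr0n.
rewrite -(ler_pM2l n0') -natrM mul_bin_down natrM mulrA ler_wpM2r //.
have := leq_subLR n k.-1 (n - k.-1); rewrite leqnn -(ler_nat R) natrD.
have : k.-1%:R <= k%:R :> R by rewrite ler_nat leq_pred.
lra.
Qed.

Lemma codegree_star : (1 < k)%N -> (1 < n)%N ->
  n%:R * 'C(n - 2, k - 2)%:R <= 2 * k%:R * D.
Proof.
move=> k1 n1; have : (n.-1 * 'C(n - 2, k - 2) = k.-1 * 'C(n.-1, k.-1))%N.
  case: k k1 => [|[|k']] // _; case: n n1 => [|[|n']] // _ /=.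
  by rewrite !subn2 /= -mul_bin_diag.
move=> E; rewrite -!natrM ler_nat -!mulnA.
apply: leq_trans (_ : 2 * (n.-1 * 'C(n - 2, k - 2)) <= _)%N.
  by rewrite mulnA leq_mul2r; apply/orP; right; lia.
by rewrite E leq_mul2l leq_mul2r leq_pred orbT.
Qed.

End Binomials.

(** * Winning criteria under explicit numerical conditions *)

Section LargeN.
Variables (R : realType) (n k m b : nat).
Local Notation N := ('C(n, k.-1)%:R : R).

(** Easing with [j0 = n %/ q]. A large [q] keeps the codegree terms below [theta * D]; the steps
    above [j0] cost [k * b] times a bound depending on [q] only, absorbed by [theta * b * ln n]. The
    lower bound on [b] absorbs the lone [m] into [theta * k * b * m]. *)
Lemma maker_wins_large_bias (q : nat) (theta : R) :
  (1 < k)%N -> (1 < n)%N -> (0 < q <= n)%N -> 0 < theta <= 1 / 8 ->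
  2 * k%:R <= theta * q%:R -> k%:R <= theta * n%:R ->
  1 <= theta * (k * b)%:R ->
  1 + k%:R * (1 + ln (2 * q%:R)) <= theta * ln (n%:R : R) ->
  b%:R * (k%:R * m%:R + ln (n%:R : R)) <= (1 - 8 * theta) * N ->
  maker_wins_min_degree n k m b.
Proof.
move=> k1 n1 /andP [q0 qn] /andP [t0 t8] kq kn bk ln_big bias.
have n0 : (0 < n)%N by rewrite ltnW.
have j0 : (0 < n %/ q)%N by rewrite divn_gt0.
apply: (maker_wins_easing k1 n0 j0 (R := R)).
have N0 : 0 < N.
  rewrite ltr0n bin_gt0; move: kn t8 t0 k1 => kn t8 t0 k1.
  rewrite -(ler_nat R); have : (k.-1)%:R <= k%:R :> R by rewrite ler_nat leq_pred.
  have n0' : 0 <= n%:R :> R by [].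
  have := ler_wpM2r n0' t8; lra.
have DN := star_ge (ltnW k1) n0 kn.
have CD := @codegree_star R n k k1 n1.
set D := ('C(n.-1, k.-1)%:R : R) in DN CD *.
set C := ('C(n - 2, k - 2)%:R : R) in CD.
have D0 : 0 <= D by rewrite /D.
have q0' : 0 < q%:R :> R by rewrite ltr0n.
have qC : (n %/ q)%:R * C <= theta * D.
  rewrite -(ler_pM2l q0'); apply: le_trans (_ : n%:R * C <= _).
    by rewrite mulrA ler_wpM2r // -natrM ler_nat mulnC leq_trunc_div.
  by apply: le_trans CD _; have := ler_wpM2r D0 kq; lra.
have jn : (n %/ q <= n)%N by rewrite leq_div.
have low : \sum_(1 <= i < n %/ q) level_step R n k b (n %/ q) i
    <= theta * D + b%:R * (1 + ln (n %/ q)%:R).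
  rewrite (eq_big_nat _ _ (F2 := fun i => C + b%:R * i%:R^-1)); last first.
    by move=> i /andP [_ ij]; rewrite /level_step ij.
  rewrite big_split /= -mulr_sumr; apply: lerD; last first.
    rewrite ler_wpM2l //; have := harmonic_le R (ltn0Sn 0) j0.
    by rewrite ln1 subr0.
  apply: le_trans qC; rewrite sumr_const_nat -[leLHS]mulr_natl ler_wpM2r //.
  by rewrite ler_nat leq_subr.
have high : \sum_(n %/ q <= i < n) level_step R n k b (n %/ q) i
    <= (k * b)%:R * (1 + ln (2 * q%:R)).
  rewrite (eq_big_nat _ _ (F2 := fun i => (k * b)%:R * i%:R^-1)); last first.
    by move=> i /andP [ij _]; rewrite /level_step ltnNge ij.
  rewrite -mulr_sumr ler_wpM2l //; apply: le_trans (harmonic_le R j0 jn) _.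
  (* As [n %/ q] is positive, [n] is at most [2 * q] times [n %/ q]. *)
  rewrite -addrA lerD2l lerBlDr -lnM ?posrE ?mulr_gt0 ?ltr0n //.
  rewrite ler_ln ?posrE ?mulr_gt0 ?ltr0n // -!natrM ler_nat.
  rewrite -mulnA mul2n -addnn [(q * _)%N]mulnC.
  apply: leq_trans (ltnW (ltn_ceil n q0)) _.
  by rewrite mulSn leq_add2r leq_pmull.
have lnj : ln (n %/ q)%:R <= ln (n%:R : R).
  by rewrite ler_ln ?posrE ?ltr0n // ler_nat.
rewrite /level (big_cat_nat j0 jn) /=.
apply: le_lt_trans (_ : m%:R * (1 + (k * b)%:R) +
  (theta * D + b%:R * (1 + ln n%:R) + (k * b)%:R * (1 + ln (2 * q%:R))) < _).
  rewrite lerD2l; apply: lerD high; apply: le_trans low _.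
  by rewrite lerD2l ler_wpM2l // lerD2l.
have m_small : m%:R <= theta * (k * b)%:R * m%:R.
  by rewrite -[leLHS]mul1r ler_wpM2r.
have b_small := ler_wpM2l (ler0n R b) ln_big.
(* All costs but [theta * D] fit into [(1 + theta) * (1 - 8 * theta) * N], which is below
   [(1 - theta) ^+ 2 * N]. *)
have t1 : 0 <= 1 + theta by lra.
have bias' := ler_wpM2l t1 bias.
have DN' : (1 - theta) * ((1 - theta) * N) <= (1 - theta) * D.
  by rewrite ler_wpM2l //; lra.
have tN : 0 < theta * N by rewrite mulr_gt0.
have ttN : 0 < theta * (theta * N) by rewrite mulr_gt0.
rewrite natrM in m_small *.
clear low high lnj qC CD kn kq DN bias ln_big bk t8 t1 N0 D0 q0'.
lra.
Qed.

(** After taking logarithms, one Maker edge offsets at most [(1 + theta) * b] Breaker edges, each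
    worth at least [lam]. What remains of the star beyond [m] such exchanges is at least
    [theta * N], worth more than [ln n]. *)
Lemma maker_wins_small_bias (theta mu : R) :
  (1 < k)%N -> (1 < n)%N -> (0 < b)%N -> 0 < theta <= 1 / 8 -> 0 < mu ->
  (1 + mu) ^+ b.+1 <= 1 + theta / 8 -> k%:R <= theta * n%:R ->
  ln (n%:R : R) < mu / (1 + mu) * (theta * n%:R) ->
  b%:R * (k%:R * m%:R + ln (n%:R : R)) <= (1 - 8 * theta) * N ->
  maker_wins_min_degree n k m b.
Proof.
move=> k1 n1 b0 /andP [t0 t8] mu0 muE kn ln_small bias.
have n0' : 0 < n%:R :> R by rewrite ltr0n ltnW.
have mu1 : 0 < 1 + mu by lra.
have bern s : 1 + s%:R * mu <= (1 + mu) ^+ s.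
  elim: s => [|s IH]; first by rewrite mul0r addr0 expr0.
  rewrite exprS -natr1; have := ler_wpM2l (ltW mu1) IH.
  have : 0 <= s%:R * (mu * mu) by rewrite mulr_ge0 // mulr_ge0 // ltW.
  lra.
have P0 : 0 <= (1 + mu) ^+ b by rewrite exprn_ge0 // ltW.
have P1 : (1 + mu) ^+ b <= 1 + theta / 8.
  by apply: le_trans muE; rewrite ler_weXn2l // lerDl ltW.
have bmu0 : 0 <= b%:R * mu by rewrite mulr_ge0 // ltW.
have bmu : b%:R * mu <= theta / 8.
  by have := le_trans (bern b.+1) muE; rewrite -natr1; lra.
set nu := discount b mu.
have nu0 : 0 <= nu by rewrite /nu /discount mulr_ge0.
have nu4 : nu <= theta / 4.
  apply: le_trans (ler_pM bmu0 P0 bmu P1) _.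
  have : theta * theta <= theta * (1 / 8) by rewrite ler_wpM2l // ltW.
  lra.
pose lam := mu / (1 + mu).
have lam0 : 0 < lam by rewrite divr_gt0.
have lamE : lam * (1 + mu) = mu by rewrite divfK // gt_eqF.
(* This bounds [nu / (1 - nu)], the quantity in the lower bound for [ln (1 - nu)]. *)
have nu_lam : nu <= (1 + theta) * (b%:R * lam) * (1 - nu).
  have bl0 : 0 <= b%:R * lam by rewrite mulr_ge0 // ltW.
  have : (1 + mu) ^+ b.+1 <= (1 + theta) * (1 - nu).
    apply: le_trans muE _.
    have := ler_wpM2l (_ : 0 <= 1 + theta) nu4.
    have : theta * theta <= theta * (1 / 8) by rewrite ler_wpM2l // ltW.
    move=> ? /(_ _); lra.
  have nuE : b%:R * lam * (1 + mu) ^+ b.+1 = nu.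
    by rewrite exprS mulrA -(mulrA _ lam) lamE.
  move=> /(ler_wpM2l bl0); rewrite nuE; lra.
have N0 : n%:R <= N.
  rewrite ler_nat bin_ge // ltn_predRL k1 /=.
  rewrite -(ltr_nat R); have : (k.-1)%:R <= k%:R :> R by rewrite ler_nat leq_pred.
  have := ler_wpM2r (ltW n0') t8; lra.
have DN := star_ge (ltnW k1) (ltnW n1) kn.
have L0 : 0 <= ln (n%:R : R) by rewrite ln_ge0 // ler1n ltnW.
(* Since [b >= 1] and [k >= 2], [b + 1 <= b * k]. *)
have bm : (b%:R + 1) * m%:R <= (1 - 8 * theta) * N.
  apply: le_trans bias; apply: le_trans (_ : b%:R * (k%:R * m%:R) <= _).
    rewrite natr1 -!natrM ler_nat mulnA leq_mul2r; apply/orP; right.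
    apply: leq_trans (_ : b * 2 <= _)%N; last by rewrite leq_mul2l k1 orbT.
    by rewrite muln2 -addnn -addn1 leq_add2l.
  by rewrite ler_wpM2l // lerDl.
have tN : 0 <= theta * N by rewrite mulr_ge0 // ltW.
have mD : (m <= 'C(n.-1, k.-1))%N.
  rewrite -(ler_nat R); apply: le_trans DN.
  have : 0 <= b%:R * m%:R :> R by rewrite mulr_ge0.
  lra.
apply: (maker_wins_potential mu0 (_ : discount b mu <= 1) (ltnW k1) mD).
  by rewrite -/nu; lra.
have nu1 : 0 < 1 - discount b mu by rewrite -/nu; lra.
rewrite -ltr_ln ?posrE ?mulr_gt0 ?exprn_gt0 // lnM ?posrE ?exprn_gt0 //.
rewrite !lnXn // -[ln (1 + mu) *+ _]mulr_natl -[ln _ *+ _]mulr_natl.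
have lnA : lam <= ln (1 + mu).
  apply: le_trans (ln_ge_1subV mu1); rewrite -(ler_pM2r mu1) lamE mulrBl.
  by rewrite mulVf ?gt_eqF // mul1r addrC addKr.
have lnB : - ((1 + theta) * (b%:R * lam)) <= ln (1 - discount b mu).
  apply: le_trans (ln_ge_1subV nu1); rewrite -/nu in nu1 *.
  rewrite -(ler_pM2r nu1) mulrBl mulVf ?gt_eqF // mul1r; lra.
apply: lt_le_trans (lerD (ler_wpM2l (ler0n R _) lnA) (ler_wpM2l (ler0n R m) lnB)).
apply: lt_le_trans ln_small _; rewrite -/lam natrB //.
have : theta * n%:R <= theta * N by rewrite ler_pM2l.
move=> tnN; apply: le_trans (_ : lam * (theta * N) <= _); first by rewrite ler_pM2l.
set D := ('C(n.-1, k.-1)%:R : R) in DN *.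
have : theta * N <= D - m%:R - (1 + theta) * b%:R * m%:R.
  have := ler_wpM2l (_ : 0 <= 1 + theta) bm.
  have : 0 <= theta * (theta * N) by rewrite mulr_ge0 // ltW.
  have : 0 <= theta * m%:R by rewrite mulr_ge0 // ltW.
  move=> ? ? /(_ _); lra.
move=> /(ler_wpM2l (ltW lam0)); lra.
Qed.

(** [U] has [2 * u] vertices, half of them spare for Maker to touch. The bound on [u * ln n] keeps
    the first phase short, [ln u] close to [ln n] gives the box sum its size, and [u <= eta * n]
    controls rounding. *)
Lemma breaker_wins_bias (u : nat) (eta : R) :
  (1 < k)%N -> (1 < n)%N -> (k <= n)%N -> (0 < m)%N -> (0 < b)%N ->
  0 < eta <= 1 / 4 ->
  (2 * k <= u)%N -> (2 * u <= n)%N ->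
  16 * k%:R ^+ 2 * (u%:R * ln (n%:R : R)) <= n%:R ->
  (1 - eta) * ln (n%:R : R) <= ln u%:R -> u%:R <= eta * n%:R ->
  (1 + 4 * eta) * N <= b%:R * ln (n%:R : R) ->
  breaker_wins_min_degree n k m b.
Proof.
have room (a c d : nat) :
  (2 * c <= d -> 2 * a <= d -> d + (a + c) <= 2 * d)%N by lia.
move=> k1 n1 kn m0 b0 /andP [eta0 eta4] ku un u_ln ln_u u_small bias.
have n0' : 0 < n%:R :> R by rewrite ltr0n ltnW.
have k0' : 0 < k%:R :> R by rewrite ltr0n ltnW.
have u0 : (0 < u)%N by apply: leq_trans ku; rewrite muln_gt0 /= ltnW.
have u0' : 0 < u%:R :> R by rewrite ltr0n.
have N_ge : n%:R <= N by rewrite ler_nat bin_ge // ltn_predRL k1 prednK // ltnW.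
have N0 : 0 < N by apply: lt_le_trans N_ge.
have L0 : 0 <= ln (n%:R : R) by rewrite ln_ge0 // ler1n ltnW.
have U0 : (#|finset.set0 : {set 'I_n}| <= 2 * u)%N by rewrite cards0.
have UT : (2 * u <= #|finset.setTfor 'I_n|)%N by rewrite cardsT card_ord.
have [U _ /andP [_ /eqP cU]] := subset_of_card (finset.sub0set _) U0 UT.
apply: (breaker_wins_isolating (U := U) k1 m0 b0 u0).
  rewrite cU; set r := (_ %/ b)%N.
  suff : (2 * (k * r) <= u)%N by move=> kr; rewrite mulnS room.
  have rb : (r * b <= 2 * u * (2 * u * 'C(n - 2, k - 2)))%N.
    by rewrite -[X in (_ <= X * (X * _))%N]cU; exact: leq_trunc_div.
  rewrite -(ler_nat R) !natrM.
  have CD := @codegree_star R n k k1 n1.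
  set C := ('C(n - 2, k - 2)%:R : R) in CD.
  have C0 : 0 <= C by rewrite /C.
  have CN : n%:R * C <= 2 * k%:R * N.
    by apply: le_trans CD _; rewrite ler_wpM2l ?mulr_ge0 ?star_le // ltW.
  have {}rb : r%:R * b%:R <= 4 * (u%:R * u%:R) * C.
    move: rb; rewrite -(ler_nat R) !natrM -/C; lra.
  have rN : r%:R * N <= 4 * (u%:R * u%:R) * C * ln n%:R.
    apply: le_trans (_ : r%:R * (b%:R * ln n%:R) <= _).
      rewrite ler_wpM2l //; apply: le_trans bias; rewrite ler_peMl ?(ltW N0) //.
      by lra.
    by rewrite mulrA ler_wpM2r.
  (* Scaled by [n * N], the claim chains [rN], then [CN], then [u_ln]. *)
  rewrite -(ler_pM2r (mulr_gt0 n0' N0)).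
  apply: le_trans (_ : 2 * k%:R * n%:R * (r%:R * N) <= _); first by lra.
  apply: le_trans (_ : 8 * k%:R * (u%:R * u%:R) * ln n%:R * (n%:R * C) <= _).
    have := ler_wpM2l (_ : 0 <= 2 * k%:R * n%:R) rN.
    rewrite !mulr_ge0 // => /(_ isT); lra.
  apply: le_trans (_ : u%:R * N * (16 * k%:R ^+ 2 * (u%:R * ln n%:R)) <= _).
    have := ler_wpM2l (_ : 0 <= 8 * k%:R * (u%:R * u%:R) * ln n%:R) CN.
    rewrite !mulr_ge0 // => /(_ isT); lra.
  have uN : 0 <= u%:R * N by rewrite mulr_ge0 // ltW.
  by have := ler_wpM2l uN u_ln; lra.
rewrite -(ler_nat R) natr_sum; apply: le_trans (star_le R n k) _.
(* Each floor [b %/ j] loses less than 1, so [u] in total. *)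
apply: le_trans (_ : b%:R * \sum_(1 <= j < u) j%:R^-1 - u%:R <= _); last first.
  apply: le_trans (_ : \sum_(1 <= j < u) (b%:R * j%:R^-1 - 1) <= _).
    rewrite sumrB -mulr_sumr lerD2l lerN2 sumr_const_nat ler_nat.
    exact: leq_subr.
  rewrite !big_nat; apply: ler_sum => j /andP [j0 _].
  rewrite lerBlDr natr1 ler_pdivrMr ?ltr0n // -natrM ler_nat ltnW //.
  exact: ltn_ceil.
(* For [eta <= 1 / 4], [(1 - eta) * (1 + 4 * eta) - eta >= 1]. *)
have hu := harmonic_ge R u0.
have := ler_wpM2l (ler0n R b) (le_trans ln_u hu).
have e1 : 0 <= 1 - eta by lra.
have := ler_wpM2l e1 bias.
have : eta * n%:R <= eta * N by rewrite ler_pM2l.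
have : 0 <= (1 / 4 - eta) * (eta * N).
  by rewrite mulr_ge0 ?subr_ge0 // mulr_ge0 // ltW.
have : 0 <= eta * N by rewrite mulr_ge0 // ltW.
move: (\sum_(1 <= j < u) _) => H; lra.
Qed.

End LargeN.

(** * Choice of constants, uniformly in [m] and [b] *)

Section Thresholds.
Variable R : realType.

Lemma exp_le_1D (p : nat) (eps : R) : 0 < eps ->
  exists2 mu : R, 0 < mu & (1 + mu) ^+ p <= 1 + eps.
Proof.
move=> eps0; have l0 : 0 < ln (1 + eps) by rewrite ln_gt0 // ltrDl.
(* By [1 + mu <= expR mu] this suffices; [p.+1] avoids dividing by zero. *)
exists (ln (1 + eps) / p.+1%:R); first by rewrite divr_gt0.
set mu := _ / _; have mu0 : 0 < mu by rewrite divr_gt0.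
apply: le_trans (_ : expR mu ^+ p <= _).
  by rewrite lerXn2r ?nnegrE ?expR_ge0 ?expR_ge1Dx // addr_ge0 // ltW.
rewrite -expRM_natl -[leRHS]lnK ?posrE ?addr_gt0 // ler_expR.
rewrite /mu mulrCA ler_piMr ?(ltW l0) // ler_pdivrMr ?ltr0n // mul1r ler_nat.
exact: leqnSn.
Qed.

(** The constants depend on [k] and [gamma] only. A bias of at least [K] is handled by easing, a
    smaller one by the potential with a single [mu] good for all [b < K]. *)
Lemma maker_wins_near (k : nat) (gamma : R) : (1 < k)%N -> gamma < 1 ->
  \forall n \near \oo%classic, forall m b : nat, (0 < b)%N ->
    b%:R * (k%:R * m%:R + ln (n%:R : R)) <= gamma * 'C(n, k.-1)%:R ->
    maker_wins_min_degree n k m b.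
Proof.
move=> k1 gamma1; pose theta := Num.min (1 / 8) ((1 - gamma) / 8).
have t0 : 0 < theta by rewrite /theta lt_min; apply/andP; split; lra.
have t8 : theta <= 1 / 8 by rewrite /theta ge_min lexx.
have gammaE : gamma <= 1 - 8 * theta.
  have : theta <= (1 - gamma) / 8 by rewrite /theta ge_min lexx orbT.
  lra.
have t08 : 0 < theta <= 1 / 8 by rewrite t0.
pose K := (Num.truncn theta^-1).+1; pose q := (Num.truncn (2 * k%:R / theta)).+1.
have Kt : 1 <= theta * K%:R.
  by rewrite mulrC -ler_pdivrMr // mul1r; apply: ltW; exact: truncnS_gt.
have qt : 2 * k%:R <= theta * q%:R.
  by rewrite [theta * _]mulrC -ler_pdivrMr //; apply: ltW; exact: truncnS_gt.
have [|mu mu0 muK] := @exp_le_1D K.+1 (theta / 8); first by rewrite divr_gt0.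
have lam0 : 0 < mu / (1 + mu) * (theta / 2).
  by rewrite mulr_gt0 ?divr_gt0 // addr_gt0.
near=> n => m b b0 bias.
have n1 : (1 < n)%N by near: n; exact: nbhs_infty_gt.
have qn : (0 < q <= n)%N by rewrite /=; near: n; exact: nbhs_infty_ge.
have kn : k%:R <= theta * n%:R.
  rewrite mulrC -ler_pdivrMr //; apply: ltW.
  by near: n; exact: nbhs_infty_gtr.
have {}bias : b%:R * (k%:R * m%:R + ln (n%:R : R)) <=
    (1 - 8 * theta) * 'C(n, k.-1)%:R.
  by apply: le_trans bias _; rewrite ler_wpM2r.
have [Kb|bK] := leqP K b.
  apply: (maker_wins_large_bias k1 n1 qn t08 qt kn _ _ bias).
    apply: le_trans Kt _; rewrite ler_pM2l // ler_nat.
    by apply: leq_trans Kb _; rewrite leq_pmull // ltnW.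
  rewrite [theta * _]mulrC -ler_pdivrMr //; near: n; exact: near_ln_ge.
apply: (maker_wins_small_bias k1 n1 b0 t08 mu0 _ kn _ bias).
  by apply: le_trans muK; rewrite ler_weXn2l ?ltnS // ?lerDl 1?ltW // ltnW.
(* Half of [theta] is given up to make the inequality strict. *)
apply: le_lt_trans (_ : mu / (1 + mu) * (theta / 2) * n%:R < _).
  by near: n; exact: near_ln_le.
have : 0 < mu / (1 + mu) * (theta / 2) * n%:R by rewrite mulr_gt0 // ltr0n ltnW.
lra.
Unshelve. all: by end_near. Qed.

Lemma breaker_wins_near (k : nat) (eps : R) : (1 < k)%N -> 0 < eps ->
  \forall n \near \oo%classic, forall m b : nat, (0 < m)%N -> (0 < b)%N ->
    (1 + eps) * 'C(n, k.-1)%:R <= b%:R * ln (n%:R : R) ->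
    breaker_wins_min_degree n k m b.
Proof.
move=> k1 eps0; pose eta := Num.min (1 / 4) (eps / 4).
have eta0 : 0 < eta by rewrite /eta lt_min; apply/andP; split; lra.
have eta4 : eta <= 1 / 4 by rewrite /eta ge_min lexx.
have etaE : 4 * eta <= eps.
  have : eta <= eps / 4 by rewrite /eta ge_min lexx orbT.
  lra.
have k0 : 0 < k%:R :> R by rewrite ltr0n ltnW.
pose delta : R := (16 * k%:R ^+ 2)^-1.
have dpos : 0 < 16 * k%:R ^+ 2 :> R by rewrite mulr_gt0 // exprn_gt0.
have delta0 : 0 < delta by rewrite invr_gt0.
have k2 : 0 < (2 * k)%:R :> R by rewrite ltr0n muln_gt0 /= ltnW.
have e2 : 0 < eta / 2 by rewrite divr_gt0.
near=> n => m b m0 b0 bias.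
have n1 : (1 < n)%N by near: n; exact: nbhs_infty_gt.
have kn : (k <= n)%N by near: n; exact: nbhs_infty_ge.
have n0 : 0 < n%:R :> R by rewrite ltr0n ltnW.
have L1 : 1 <= ln (n%:R : R) by near: n; exact: near_ln_ge.
have L0 : 0 < ln (n%:R : R) by apply: lt_le_trans L1.
(* This is the largest [u] with [16 * k ^+ 2 * u * ln n <= n], before rounding down. *)
set x := delta * n%:R / ln n%:R.
have x0 : 0 < x by rewrite divr_gt0 // mulr_gt0.
have xL : x * ln n%:R = delta * n%:R by rewrite divfK // gt_eqF.
have [ux xu] : (Num.truncn x)%:R <= x /\ x < (Num.truncn x).+1%:R.
  by have := truncn_itv (ltW x0) => /andP [].
have ku : (2 * k <= Num.truncn x)%N.
  rewrite truncn_ge_nat ?(ltW x0) // ler_pdivlMr // -ler_pdivlMl //.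
  rewrite mulrA; near: n; apply: near_ln_le.
  by rewrite mulr_gt0 // invr_gt0.
move: (Num.truncn x) ux xu ku => u ux xu ku.
have u0 : (0 < u)%N by apply: leq_trans ku; rewrite muln_gt0 /= ltnW.
have u0' : 0 < u%:R :> R by rewrite ltr0n.
have u_small : u%:R <= eta * n%:R.
  apply: le_trans ux _; rewrite ler_pdivrMr // mulrAC ler_pM2r //.
  by rewrite mulrC -ler_pdivrMr //; near: n; exact: near_ln_ge.
apply: (@breaker_wins_bias R n k m b u eta) => //.
- by rewrite eta0.
- rewrite -(ler_nat R) natrM; have := ler_wpM2r (ltW n0) eta4; lra.
- apply: le_trans (_ : 16 * k%:R ^+ 2 * (delta * n%:R) <= _).
    by rewrite ler_pM2l // -xL ler_pM2r.
  by rewrite mulrA mulfV ?gt_eqF // mul1r.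
(* As [x <= 2 * u], [ln u] falls short of [ln n] by at most [ln 2 - ln delta + ln (ln n)]. *)
- have u2 : 0 < 2 * u%:R :> R by rewrite mulr_gt0.
  have : ln x <= ln (2 * u%:R).
    rewrite ler_ln ?posrE //; apply: ltW; apply: lt_le_trans xu _.
    by rewrite -natrM ler_nat mul2n -addnn -addn1 leq_add2l.
  rewrite /x ln_div ?posrE ?mulr_gt0 // !lnM ?posrE //.
  have : ln (ln (n%:R : R)) <= eta / 2 * ln n%:R.
    by near: n; exact: near_lnln_le.
  have : ln 2 - ln delta <= eta / 2 * ln n%:R.
    by rewrite mulrC -ler_pdivrMr //; near: n; exact: near_ln_ge.
  lra.
- by apply: le_trans bias; rewrite ler_wpM2r // lerD2l.
Unshelve. all: by end_near. Qed.

End Thresholds.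

(** * Deduction of the thresholds *)

Local Open Scope classical_set_scope.

Theorem theorem1 (R : realType) (k : nat) (hk : (2 <= k)%N)
    (m : nat -> nat) (hm : forall n, (0 < m n)%N) :
  ((fun n : nat => (m n)%:R : R) =o_\oo (fun n : nat => ln (n%:R : R)) ->
    forall eps : R, 0 < eps ->
    \forall n \near \oo, forall (b : nat) (beta : R), (0 < b)%N ->
      b%:R = beta * 'C(n, k.-1)%:R / ln (n%:R : R) ->
      (beta <= 1 - eps -> maker_wins_min_degree n k (m n) b) /\
      (1 + eps <= beta -> breaker_wins_min_degree n k (m n) b))
  /\
  ((fun n : nat => (m n)%:R : R) =Omega_\oo (fun n : nat => ln (n%:R : R)) ->
    forall gamma : R, gamma < 1 ->
    \forall n \near \oo, forall b : nat, (0 < b)%N ->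
      b%:R <= gamma * 'C(n, k.-1)%:R / (k%:R * (m n)%:R + ln (n%:R : R)) ->
      maker_wins_min_degree n k (m n) b).
Proof.
have k0 : 0 < k%:R :> R by rewrite ltr0n ltnW.
split=> [mo eps eps0|_ gamma gamma1].
  (* Eventually [k * m <= eps * ln n], so [k * m + ln n <= (1 + eps) * ln n], and Maker's half of
     (i) reduces to [maker_wins_near] with this product as [gamma]. *)
  have gamma1 : (1 + eps) * (1 - eps) < 1.
    by rewrite mulrC -subr_sqr expr1n ltrBlDr ltrDl exprn_gt0.
  have ek0 : 0 < eps / k%:R by rewrite divr_gt0.
  have m_small : \forall n \near \oo,
      `|(m n)%:R : R| <= eps / k%:R * `|ln (n%:R : R)|.
    by move: mo => /eqoP /(_ _ ek0).
  near=> n => b beta b0 bE.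
  have L0 : 0 < ln (n%:R : R).
    by apply: lt_le_trans ltr01 _; near: n; exact: near_ln_ge.
  have {}bE : b%:R * ln (n%:R : R) = beta * 'C(n, k.-1)%:R.
    by rewrite bE divfK // gt_eqF.
  have N0 : 0 <= 'C(n, k.-1)%:R :> R by [].
  split=> [beta_le|beta_ge].
    have maker : forall m b : nat, (0 < b)%N ->
        b%:R * (k%:R * m%:R + ln (n%:R : R)) <=
          (1 + eps) * (1 - eps) * 'C(n, k.-1)%:R ->
        maker_wins_min_degree n k m b.
      by near: n; exact: maker_wins_near.
    apply: maker b0 _.
    have : `|(m n)%:R : R| <= eps / k%:R * `|ln (n%:R : R)| by near: n.
    rewrite !ger0_norm ?(ltW L0) // mulrAC ler_pdivlMr // mulrC => km.
    apply: le_trans (_ : (1 + eps) * (b%:R * ln n%:R) <= _).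
      by have := ler_wpM2l (ler0n R b) km; lra.
    by rewrite bE -mulrA ler_pM2l ?addr_gt0 // ler_wpM2r.
  have breaker : forall m b : nat, (0 < m)%N -> (0 < b)%N ->
      (1 + eps) * 'C(n, k.-1)%:R <= b%:R * ln (n%:R : R) ->
      breaker_wins_min_degree n k m b.
    by near: n; exact: breaker_wins_near.
  by apply: breaker => //; rewrite bE ler_wpM2r.
near=> n => b b0.
have L0 : 0 <= ln (n%:R : R) by near: n; exact: near_ln_ge.
rewrite ler_pdivlMr; last first.
  by rewrite ltr_wpDr // mulr_gt0 // ltr0n.
have maker : forall m b : nat, (0 < b)%N ->
    b%:R * (k%:R * m%:R + ln (n%:R : R)) <= gamma * 'C(n, k.-1)%:R ->
    maker_wins_min_degree n k m b.
  by near: n; exact: maker_wins_near.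
exact: maker.
Unshelve. all: by end_near. Qed.
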